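(* Given $g\in[1,t]$, consider $\mathcal{G}=\{j\in[1,t] : r^g=r^j\}$. Then, $(\alpha^*,\eta^*,z^* )$ is a solution to Problem (P1) if and only if there exists a vector $\bar\alpha\in\mathbb{R}^{t+1-|\mathcal{G}|}$ (with entries indexed by $\{g\}\cup[1,t]\setminus\mathcal{G}$) such that $(\bar\alpha,\eta^*,z^* )$ is a solution to the problem (P3) $$\min_{\alpha,\eta,z}\ \eta$$ subject to $$\sum_{j\in[1,t]\setminus\mathcal{G}}\alpha_jr_i^j+|\mathcal{G}|\,\alpha_gr_i^g\le -1+z_iM,\quad i\in[1,m],$$ $$\sum_{j\in[1,t]\setminus\mathcal{G}}\alpha_jr_i^j+|\mathcal{G}|\,\alpha_gr_i^g\ge 1-(1-z_i)M,\quad i\in[1,m],$$ $$\lambda-\eta\le\sum_{i=1}^m z_i\le\lambda+\eta,$$ $$\ell\le\alpha_j\le u,\quad j\in\{g\}\cup[1,t]\setminus\mathcal{G},$$ $$0\le\eta\le\bar\eta,$$ $$z_i\in\{0,1\},\quad i\in[1,m].$$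
   Context: Notation: $[1,n]=\{1,\dots,n\}$ for a positive integer $n$, and $\{g\}\cup[1,t]\setminus\mathcal{G}$ means $\{g\}\cup([1,t]\setminus\mathcal{G})$. Here $t$ is the number of decision trees, $m$ is the number of unlabeled points, $r_i^j\in\{-1,1\}$ is the classification of the $i$-th unlabeled point by tree $j$, $r_i=(r_i^1,\dots,r_i^t)\in\{-1,1\}^t$ is the vector of classifications of the $i$-th unlabeled point by all trees, $r^j=(r_1^j,\dots,r_m^j)\in\{-1,1\}^m$ is the vector of classifications of all unlabeled points by tree $j$, and $\lambda\in\mathbb{N}$ is the known total number of the $m$ unlabeled points that belong to the positive class (so $\lambda\le m$). Further, $u>\ell>0$ are real numbers, $\bar\eta=\max\{\lambda,m-\lambda\}$, and $M$ is a big-$M$ constant, the same in (P1) and (P3), that is chosen sufficiently large (for instance, $M=ut+1$ is a valid choice). A solution to a problem is a point that solves the optimization problem, i.e., an optimal point. Problem (P1) is the mixed-integer linear problem in the variables $\alpha\in\mathbb{R}^t$, $\eta\in\mathbb{R}$, $z\in\{0,1\}^m$: $$\min_{\alpha,\eta,z}\ \eta$$ subject to $$\alpha^\top r_i\le -1+z_iM,\quad i\in[1,m],$$ $$\alpha^\top r_i\ge 1-(1-z_i)M,\quad i\in[1,m],$$ $$\lambda-\eta\le\sum_{i=1}^m z_i\le\lambda+\eta,$$ $$\ell\le\alpha_j\le u,\quad j\in[1,t],$$ $$0\le\eta\le\bar\eta,$$ $$z_i\in\{0,1\},\quad i\in[1,m].$$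
   Formalization: The ''if'' direction is false for an arbitrary fixed α* (e.g. one outside [ℓ,u]^t), so the left side is read as: there exists α* such that (α*,η*,z* ) is a solution to (P1). *)

(* Defs.v *)
From HB Require Import structures.
From mathcomp Require Import all_boot all_order all_algebra.
From mathcomp Require Import reals.
Set Implicit Arguments.
Unset Strict Implicit.
Unset Printing Implicit Defensive.
Import Order.TTheory GRing.Theory Num.Theory.
Local Open Scope ring_scope.

(* The classifications form a matrix r with r i j the classification of the
   i-th unlabeled point by tree j: r_i is [row i r] and r^j is [col j r]. *)

Definition is_solution (R : realType) (X : Type) (feasible : X -> Prop)
    (objective : X -> R) (x : X) : Prop :=
  feasible x /\ forall y, feasible y -> objective x <= objective y.

Definition eta_bar (R : realType) (m lambda : nat) : R :=
  Num.max lambda%:R (m%:R - lambda%:R).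

(* "M is sufficiently large": over the box [l, u]^t, the first constraint of a
   point i is redundant when z_i = 1, and the second one when z_i = 0. *)
Definition bigM_valid (R : realType) (t m : nat) (r : 'M[R]_(m, t))
    (l u M : R) : Prop :=
  forall alpha : 'rV[R]_t, (forall j, l <= alpha 0 j <= u) ->
  forall i, \sum_j alpha 0 j * r i j <= -1 + M /\
            \sum_j alpha 0 j * r i j >= 1 - M.

Lemma bigM_validP (R : realType) (t m : nat) (r : 'M[R]_(m, t)) (l u M : R) :
  (forall i j, r i j = -1 \/ r i j = 1) -> 0 < l -> u * t%:R + 1 <= M ->
  bigM_valid r l u M.
Proof.
move=> hr l0 hM alpha ha i.
have : `|\sum_j alpha 0 j * r i j| <= u * t%:R.
  apply: le_trans (ler_norm_sum _ _ _) _.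
  apply: (@le_trans _ _ (\sum_(j < t) u)); last first.
    by rewrite sumr_const card_ord mulr_natr.
  apply: ler_sum => j _; rewrite normrM.
  have /andP[lj uj] := ha j.
  have -> : `|r i j| = 1 by case: (hr i j) => ->; rewrite ?normrN normr1.
  by rewrite mulr1 ger0_norm // (le_trans (ltW l0)).
rewrite ler_norml => /andP[h1 h2]; split.
  by rewrite addrC lerBrDr (le_trans _ hM) // lerD2r.
by apply: le_trans h1; rewrite lerNr opprB lerBrDr.
Qed.

Definition P1_feasible (R : realType) (t m : nat) (r : 'M[R]_(m, t))
    (lambda : nat) (l u M : R) (x : 'rV[R]_t * R * 'rV[R]_m) : Prop :=
  let: (alpha, eta, z) := x in
  (forall i, \sum_j alpha 0 j * r i j <= -1 + z 0 i * M) /\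
  (forall i, \sum_j alpha 0 j * r i j >= 1 - (1 - z 0 i) * M) /\
  lambda%:R - eta <= \sum_i z 0 i <= lambda%:R + eta /\
  (forall j, l <= alpha 0 j <= u) /\
  0 <= eta <= eta_bar R m lambda /\
  (forall i, z 0 i = 0 \/ z 0 i = 1).

Definition P1_solution (R : realType) (t m : nat) (r : 'M[R]_(m, t))
    (lambda : nat) (l u M : R) : 'rV[R]_t * R * 'rV[R]_m -> Prop :=
  is_solution (P1_feasible r lambda l u M) (fun x => x.1.2).

Definition same_trees (R : realType) (t m : nat) (r : 'M[R]_(m, t))
    (g : 'I_t) : {set 'I_t} := [set j | col g r == col j r].

(* The index set {g} \cup ([1,t] \ G) of the entries of alpha in (P3). *)
Definition P3_index (R : realType) (t m : nat) (r : 'M[R]_(m, t))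
    (g : 'I_t) : finType := {j : 'I_t | j \in g |: ~: same_trees r g}.

Definition P3_index_g (R : realType) (t m : nat) (r : 'M[R]_(m, t))
    (g : 'I_t) : P3_index r g :=
  exist _ g (setU11 g (~: same_trees r g)).

Lemma card_P3_index (R : realType) (t m : nat) (r : 'M[R]_(m, t))
    (g : 'I_t) : #|P3_index r g| = (t + 1 - #|same_trees r g|)%N.
Proof.
rewrite card_sig cardsU1 !inE eqxx /=.
have := cardsC (same_trees r g); rewrite card_ord => ht.
by rewrite -[X in _ = (X + 1 - _)%N]ht -addnA addKn addnC.
Qed.

Definition P3_lhs (R : realType) (t m : nat) (r : 'M[R]_(m, t)) (g : 'I_t)
    (alpha : {ffun P3_index r g -> R}) (i : 'I_m) : R :=
  \sum_(j : P3_index r g | val j \notin same_trees r g)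
    alpha j * r i (val j)
  + #|same_trees r g|%:R * alpha (P3_index_g r g) * r i g.

Definition P3_feasible (R : realType) (t m : nat) (r : 'M[R]_(m, t))
    (lambda : nat) (l u M : R) (g : 'I_t)
    (x : {ffun P3_index r g -> R} * R * 'rV[R]_m) : Prop :=
  let: (alpha, eta, z) := x in
  (forall i, P3_lhs alpha i <= -1 + z 0 i * M) /\
  (forall i, P3_lhs alpha i >= 1 - (1 - z 0 i) * M) /\
  lambda%:R - eta <= \sum_i z 0 i <= lambda%:R + eta /\
  (forall j, l <= alpha j <= u) /\
  0 <= eta <= eta_bar R m lambda /\
  (forall i, z 0 i = 0 \/ z 0 i = 1).

Definition P3_solution (R : realType) (t m : nat) (r : 'M[R]_(m, t))
    (lambda : nat) (l u M : R) (g : 'I_t) :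
    {ffun P3_index r g -> R} * R * 'rV[R]_m -> Prop :=
  is_solution (@P3_feasible R t m r lambda l u M g) (fun x => x.1.2).

(* Main.v *)
Require Import Defs.
From mathcomp Require Import all_boot all_order all_algebra.
From mathcomp Require Import reals.
Import Order.TTheory GRing.Theory Num.Theory.
Local Open Scope ring_scope.

Set Implicit Arguments.
Unset Strict Implicit.

(** Trees of [same_trees r g] classify every unlabeled point alike, so the
    constraints of the first problem see their weights only through the sum of
    these weights. Replacing the weights of the class by their mean therefore
    changes no score, and the mean of numbers of [[l, u]] is in [[l, u]];
    conversely, a single weight for the class can be handed to each of its
    members. These two maps ([merge_weights] and [spread_weights]) preserve the
    scores ([P3_lhs_merge] and [score_spread]) and the box, and leave [eta] and
    [z] alone. Hence the two problems have the same feasible pairs [(eta, z)],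
    and, as the objective is [eta], the same optimal ones
    ([is_solution_transfer]). *)

(** Optimality of [y] asks only that no feasible point of the second problem
    has a smaller objective, and such a point would yield one of the first
    problem with the same objective. *)
Lemma is_solution_transfer (R : realType) (A B Z : Type)
    (P : A * R * Z -> Prop) (Q : B * R * Z -> Prop)
    (a : A) (b : B) (y : R) (z : Z) :
  (forall b y z, Q (b, y, z) -> exists a, P (a, y, z)) ->
  Q (b, y, z) ->
  is_solution P (fun x => x.1.2) (a, y, z) ->
  is_solution Q (fun x => x.1.2) (b, y, z).
Proof.
move=> QP Qb [_ opt]; split=> // -[[b' y'] z'] /QP[a' Pa'].
exact: opt _ Pa'.
Qed.

Lemma row_same_trees (R : realType) (t m : nat) (r : 'M[R]_(m, t))
    (g j : 'I_t) (i : 'I_m) : j \in same_trees r g -> r i j = r i g.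
Proof. by rewrite inE => /eqP/colP/(_ i); rewrite !mxE. Qed.

Lemma mem_same_trees (R : realType) (t m : nat) (r : 'M[R]_(m, t))
    (g : 'I_t) : g \in same_trees r g.
Proof. by rewrite inE. Qed.

(** The tree [g] stands for its whole class, which acts as one tree whose weight
    is the total weight of the class: the common shape of the left-hand sides of
    both problems. *)
Lemma score_same_trees (R : realType) (t m : nat) (r : 'M[R]_(m, t))
    (g : 'I_t) (alpha : 'rV[R]_t) (i : 'I_m) :
  \sum_j alpha 0 j * r i j =
  \sum_(j | j \notin same_trees r g) alpha 0 j * r i j
  + (\sum_(j in same_trees r g) alpha 0 j) * r i g.
Proof.
rewrite (bigID (mem (same_trees r g))) /= addrC mulr_suml; congr (_ + _).
by apply: eq_bigr => j /row_same_trees ->.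
Qed.

Lemma sum_P3_index (R : realType) (t m : nat) (r : 'M[R]_(m, t)) (g : 'I_t)
    (F : 'I_t -> R) :
  \sum_(k : P3_index r g | val k \notin same_trees r g) F (val k) =
  \sum_(j | j \notin same_trees r g) F j.
Proof.
rewrite [RHS](reindex_onto val (insubd (P3_index_g r g))) => [|j jG] /=.
  by apply: eq_bigl => k; rewrite valKd eqxx andbT.
by rewrite insubdK // in_setU in_setC jG orbT.
Qed.

(** The mean, not the total: the second problem multiplies the weight of [g] by
    the size of the class and still asks that weight to lie in [[l, u]]. *)
Definition mean_weight (R : realType) (t : nat) (G : {set 'I_t})
    (alpha : 'rV[R]_t) : R := (\sum_(j in G) alpha 0 j) / #|G|%:R.

Definition merge_weights (R : realType) (t m : nat) (r : 'M[R]_(m, t))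
    (g : 'I_t) (alpha : 'rV[R]_t) : {ffun P3_index r g -> R} :=
  [ffun k => if val k \in same_trees r g
             then mean_weight (same_trees r g) alpha else alpha 0 (val k)].

(** The only member of [same_trees r g] in the index type is [g], which is also
    the default of [insubd]: the whole class thus receives the weight of [g],
    and each other tree keeps its own. *)
Definition spread_weights (R : realType) (t m : nat) (r : 'M[R]_(m, t))
    (g : 'I_t) (alpha : {ffun P3_index r g -> R}) : 'rV[R]_t :=
  \row_j alpha (insubd (P3_index_g r g) j).

Lemma card_same_trees_gt0 (R : realType) (t m : nat) (r : 'M[R]_(m, t))
    (g : 'I_t) : 0 < #|same_trees r g|%:R :> R.
Proof. by rewrite ltr0n; apply/card_gt0P; exists g; exact: mem_same_trees. Qed.

Lemma mean_weight_itv (R : realType) (t : nat) (G : {set 'I_t})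
    (alpha : 'rV[R]_t) (l u : R) :
  0 < #|G|%:R :> R -> (forall j, l <= alpha 0 j <= u) ->
  l <= mean_weight G alpha <= u.
Proof.
move=> G0 box; rewrite /mean_weight ler_pdivlMr // ler_pdivrMr //.
by rewrite !mulr_natr -!sumr_const !ler_sum // => j _; case/andP: (box j).
Qed.

Lemma P3_lhs_merge (R : realType) (t m : nat) (r : 'M[R]_(m, t)) (g : 'I_t)
    (alpha : 'rV[R]_t) (i : 'I_m) :
  P3_lhs (merge_weights r g alpha) i = \sum_j alpha 0 j * r i j.
Proof.
rewrite (score_same_trees r g) -sum_P3_index /P3_lhs; congr (_ + _).
  by apply: eq_bigr => k /negbTE kG; rewrite ffunE kG.
rewrite ffunE /= mem_same_trees /mean_weight mulrCA divff ?mulr1 //.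
by rewrite gt_eqF // card_same_trees_gt0.
Qed.

Lemma insubd_same_trees (R : realType) (t m : nat) (r : 'M[R]_(m, t))
    (g j : 'I_t) :
  j \in same_trees r g -> insubd (P3_index_g r g) j = P3_index_g r g.
Proof.
move=> jG; apply: val_inj; rewrite val_insubd in_setU in_setC jG orbF in_set1.
by case: eqP.
Qed.

Lemma score_spread (R : realType) (t m : nat) (r : 'M[R]_(m, t)) (g : 'I_t)
    (alpha : {ffun P3_index r g -> R}) (i : 'I_m) :
  \sum_j spread_weights alpha 0 j * r i j = P3_lhs alpha i.
Proof.
rewrite (score_same_trees r g) -sum_P3_index /P3_lhs; congr (_ + _ * _).
  by apply: eq_bigr => k _; rewrite mxE valKd.
rewrite (eq_bigr (fun=> alpha (P3_index_g r g))) => [|j jG].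
  by rewrite sumr_const mulr_natl.
by rewrite mxE insubd_same_trees.
Qed.

Lemma P1_P3_feasible (R : realType) (t m : nat) (r : 'M[R]_(m, t))
    (lambda : nat) (l u M : R) (g : 'I_t) alpha eta z :
  P1_feasible r lambda l u M (alpha, eta, z) ->
  P3_feasible lambda l u M (merge_weights r g alpha, eta, z).
Proof.
case=> [neg [pos [card [box bounds]]]].
split; first by move=> i; rewrite P3_lhs_merge.
split; first by move=> i; rewrite P3_lhs_merge.
split=> //; split=> // k; rewrite ffunE; case: ifP => _ //.
by apply: mean_weight_itv => //; exact: card_same_trees_gt0.
Qed.

Lemma P3_P1_feasible (R : realType) (t m : nat) (r : 'M[R]_(m, t))
    (lambda : nat) (l u M : R) (g : 'I_t) (alpha : {ffun P3_index r g -> R})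
    eta z :
  P3_feasible lambda l u M (alpha, eta, z) ->
  P1_feasible r lambda l u M (spread_weights alpha, eta, z).
Proof.
case=> [neg [pos [card [box bounds]]]].
split; first by move=> i; rewrite score_spread.
split; first by move=> i; rewrite score_spread.
by split=> //; split=> // j; rewrite mxE.
Qed.

Unset Implicit Arguments.
Set Strict Implicit.

Theorem proposition4 (R : realType) (t m : nat) (r : 'M[R]_(m, t))
    (lambda : nat) (l u M : R) (g : 'I_t)
    (m_gt0 : (0 < m)%N)
    (r_pm1 : forall i j, r i j = -1 \/ r i j = 1)
    (lambda_le : (lambda <= m)%N)
    (l_gt0 : 0 < l) (l_lt_u : l < u)
    (M_large : bigM_valid r l u M)
    (eta_star : R) (z_star : 'rV[R]_m) :
  (exists alpha_star : 'rV[R]_t,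
     P1_solution r lambda l u M (alpha_star, eta_star, z_star)) <->
  (exists alpha_bar : {ffun P3_index r g -> R},
     P3_solution lambda l u M (alpha_bar, eta_star, z_star)).
Proof.
split=> -[alpha sol].
- exists (merge_weights r g alpha).
  apply: (is_solution_transfer _ _ sol) => [b y z feas|].
    by exists (spread_weights b); exact: P3_P1_feasible.
  exact: P1_P3_feasible sol.1.
- exists (spread_weights alpha).
  apply: (is_solution_transfer _ _ sol) => [a y z feas|].
    by exists (merge_weights r g a); exact: P1_P3_feasible.
  exact: P3_P1_feasible sol.1.
Qed.
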